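(* Let $\mathcal{A}$ be a unital $C^*$-algebra of real rank zero with $\dim\mathcal{A}>1$, and let $\mathcal{I}$ be an essential ideal in $\mathcal{A}$. Then for every $T\in\mathcal{A}$ and every $\varepsilon>0$, there exists an element $X\in\mathcal{I}$ with $\|X\|<\varepsilon$ such that the spectrum of $T+X$ is disconnected.
   Context: A unital $C^*$-algebra $\mathcal{A}$ has real rank zero if the set of self-adjoint elements with finite spectrum is norm dense in the set $\mathcal{A}_{sa}$ of self-adjoint elements of $\mathcal{A}$. Ideals are two-sided and are not assumed to be norm closed (nor self-adjoint). An ideal $\mathcal{I}$ of $\mathcal{A}$ is essential if, for every $A\in\mathcal{A}$, $A\mathcal{I}=\{0\}$ implies $A=0$ (equivalently, for every $A\in\mathcal{A}$, $\mathcal{I}A=\{0\}$ implies $A=0$). *)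

(* Defs.v *)
From HB Require Import structures.
From mathcomp Require Import all_boot all_order all_algebra.
From mathcomp Require Import all_classical all_reals topology normedtype.
From mathcomp.real_closed Require Import complex.

Set Implicit Arguments.
Unset Strict Implicit.
Unset Printing Implicit Defensive.

Import Order.TTheory GRing.Theory Num.Theory.
Import numFieldNormedType.Exports.

Local Open Scope classical_set_scope.
Local Open Scope ring_scope.

(* The product is a field of the mixin because the hierarchy of the library has
   no join of rings and normed Z-modules below numDomainType, and does not
   allow one to be added afterwards.  The algebra structure on the carrier is
   the instance declared below, so that 1, * and %:A are available.
   The norm of a normed module over R[i] takes its values in R[i], in the
   nonnegative reals: x <= y in R[i] means that y - x is real and nonnegative. *)
HB.mixin Record isCStarAlgebra (R : realType) A & CompleteNormedModule R[i] A := {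
  cstar_one : A;
  cstar_mul : A -> A -> A;
  star : A -> A;
  cstar_mulA : associative cstar_mul;
  cstar_mul1l : left_id cstar_one cstar_mul;
  cstar_mul1r : right_id cstar_one cstar_mul;
  cstar_mulDl : left_distributive cstar_mul +%R;
  cstar_mulDr : right_distributive cstar_mul +%R;
  cstar_one_neq0 : cstar_one != 0;
  cstar_scaleAl : forall (c : R[i]) (a b : A),
    c *: cstar_mul a b = cstar_mul (c *: a) b;
  cstar_scaleAr : forall (c : R[i]) (a b : A),
    c *: cstar_mul a b = cstar_mul a (c *: b);
  starK : involutive star;
  starD : {morph star : a b / a + b};
  starZ : forall (c : R[i]) (a : A), star (c *: a) = c^* *: star a;
  star_mul : forall a b : A,
    star (cstar_mul a b) = cstar_mul (star b) (star a);
  cstar_normM : forall a b : A, `|cstar_mul a b| <= `|a| * `|b|;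
  cstar_norm : forall a : A, `|cstar_mul (star a) a| = `|a| ^+ 2
}.

(* Unital C*-algebras, with 1 != 0 because the library's algebras require it. *)
#[short(type="cstarAlgType")]
HB.structure Definition CStarAlgebra (R : realType) :=
  {A of CompleteNormedModule R[i] A & isCStarAlgebra R A}.

#[non_forgetful_inheritance]
HB.instance Definition _ (R : realType) (A : cstarAlgType R) :=
  GRing.Zmodule_isNzRing.Build A (@cstar_mulA R A) (@cstar_mul1l R A)
    (@cstar_mul1r R A) (@cstar_mulDl R A) (@cstar_mulDr R A)
    (@cstar_one_neq0 R A).
#[non_forgetful_inheritance]
HB.instance Definition _ (R : realType) (A : cstarAlgType R) :=
  GRing.Lmodule_isLalgebra.Build R[i] A (@cstar_scaleAl R A).
#[non_forgetful_inheritance]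
HB.instance Definition _ (R : realType) (A : cstarAlgType R) :=
  GRing.Lalgebra_isAlgebra.Build R[i] A (@cstar_scaleAr R A).

Lemma starM (R : realType) (A : cstarAlgType R) (a b : A) :
  star (a * b) = star b * star a.
Proof. exact: star_mul. Qed.

Lemma cstar_ler_normM (R : realType) (A : cstarAlgType R) (a b : A) :
  `|a * b| <= `|a| * `|b|.
Proof. exact: cstar_normM. Qed.

Lemma norm_starM (R : realType) (A : cstarAlgType R) (a : A) :
  `|star a * a| = `|a| ^+ 2.
Proof. exact: cstar_norm. Qed.

Definition self_adjoint (R : realType) (A : cstarAlgType R) : set A :=
  [set a | star a = a].

Definition invertible (A : pzRingType) (a : A) : Prop :=
  exists b : A, a * b = 1 /\ b * a = 1.

(* R[i]^o is R[i] with its usual topology, given by the modulus. *)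
Definition spectrum (R : realType) (A : cstarAlgType R) (a : A) : set R[i]^o :=
  [set l : R[i] | ~ invertible (a - l%:A)].

Definition real_rank_zero (R : realType) (A : cstarAlgType R) : Prop :=
  @self_adjoint R A `<=`
    closure [set a : A | self_adjoint a /\ finite_set (spectrum a)].

Definition linearly_independent (K : fieldType) (V : lmodType K) (n : nat)
    (v : 'I_n -> V) : Prop :=
  forall c : 'I_n -> K, \sum_i c i *: v i = 0 -> forall i, c i = 0.

(* Infinite-dimensional V are included. *)
Definition dim_gt (K : fieldType) (V : lmodType K) (n : nat) : Prop :=
  exists v : 'I_n.+1 -> V, linearly_independent v.

(* Closure under scalars follows, since c *: x = c%:A * x. *)
Record two_sided_ideal (A : pzRingType) (I : set A) : Prop := TwoSidedIdeal {
  ideal0 : I 0;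
  idealB : forall x y : A, I x -> I y -> I (x - y);
  idealMl : forall a x : A, I x -> I (a * x);
  idealMr : forall a x : A, I x -> I (x * a)
}.

Definition essential (A : pzRingType) (I : set A) : Prop :=
  forall a : A, [set a * x | x in I] = [set 0] -> a = 0.

(* Main.v *)
(* Let l0 be a point of the spectrum of T with l0 + t in the resolvent set for
   all t > 0, and put S = T - l0.  As S is a non-invertible limit of invertible
   elements, S^* S is not invertible, and real rank zero gives a projection
   P <> 0 with S P small.  Essentiality gives x in I with P x <> 0; a spectral
   projection Q of a finite-spectrum approximation of P x x^* P, for an
   eigenvalue of maximal modulus, lies in I and almost below P, so S Q is small.
   If Q = 1 then I = A and any nontrivial projection will do instead.
   Now T - S Q + d Q is upper triangular for 1 = Q + (1 - Q), with corner l0 + d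
   on Q.  The point l0 + d is isolated in the spectrum because the resolvent of
   T is bounded near it by a bound chosen before Q, and it is not the only point
   because the corner (1 - Q) A (1 - Q) has nonempty spectra.
   The spectral radius facts are obtained from Rickart's argument with averages
   of the resolvent over roots of unity instead of complex integration. *)

Require Import Defs.
From mathcomp Require Import all_boot all_order all_algebra.
From mathcomp Require Import all_classical all_reals topology normedtype.
From mathcomp Require Import sequences.
From mathcomp.real_closed Require Import complex.
From mathcomp Require Import ring lra.

Set Implicit Arguments.
Unset Strict Implicit.
Unset Printing Implicit Defensive.

Import Order.TTheory GRing.Theory Num.Theory.
Import numFieldNormedType.Exports.
Import ComplexField.Normc.

Local Open Scope classical_set_scope.
Local Open Scope ring_scope.

(** * The norm as a real number *)

(** The norm is real, so its real part loses nothing and moves all estimates into [R], where the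
    order is total. *)
Definition nrm (R : realType) (A : cstarAlgType R) (a : A) : R :=
  complex.Re `|a|.

Lemma nrmE (R : realType) (A : cstarAlgType R) (a : A) :
  `|a| = ((nrm a)%:C)%C.
Proof. by rewrite RRe_real // normr_real. Qed.

Lemma nrm_ge0 (R : realType) (A : cstarAlgType R) (a : A) : 0 <= nrm a.
Proof. by rewrite -ler0c -nrmE. Qed.

Lemma nrm0_eq0 (R : realType) (A : cstarAlgType R) (a : A) :
  nrm a = 0 -> a = 0.
Proof. by move=> a0; apply/eqP; rewrite -normr_eq0 nrmE a0. Qed.

Lemma nrm_eq0 (R : realType) (A : cstarAlgType R) (a : A) :
  (nrm a == 0) = (a == 0).
Proof. by apply/eqP/eqP => [/nrm0_eq0//|->]; rewrite /nrm normr0. Qed.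

Lemma nrm0 (R : realType) (A : cstarAlgType R) : nrm (0 : A) = 0.
Proof. by rewrite /nrm normr0. Qed.

Lemma nrm_gt0 (R : realType) (A : cstarAlgType R) (a : A) :
  (0 < nrm a) = (a != 0).
Proof. by rewrite lt_neqAle nrm_ge0 andbT eq_sym nrm_eq0. Qed.

Lemma nrmN (R : realType) (A : cstarAlgType R) (a : A) : nrm (- a) = nrm a.
Proof. by rewrite /nrm normrN. Qed.

Lemma nrmC (R : realType) (A : cstarAlgType R) (a b : A) :
  nrm (a - b) = nrm (b - a).
Proof. by rewrite /nrm distrC. Qed.

Lemma nrmD (R : realType) (A : cstarAlgType R) (a b : A) :
  nrm (a + b) <= nrm a + nrm b.
Proof. by rewrite -lecR rmorphD/= -!nrmE ler_normD. Qed.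

Lemma nrmM (R : realType) (A : cstarAlgType R) (a b : A) :
  nrm (a * b) <= nrm a * nrm b.
Proof. by rewrite -lecR rmorphM/= -!nrmE cstar_ler_normM. Qed.

Lemma nrmZ (R : realType) (A : cstarAlgType R) (c : R[i]) (a : A) :
  nrm (c *: a) = normc c * nrm a.
Proof.
by apply: complexI; rewrite rmorphM/= -!nrmE normrZ normc_def; case: c.
Qed.

Lemma nrm_star_mul (R : realType) (A : cstarAlgType R) (a : A) :
  nrm (star a * a) = nrm a ^+ 2.
Proof. by apply: complexI; rewrite rmorphXn/= -!nrmE norm_starM. Qed.

Lemma star1 (R : realType) (A : cstarAlgType R) : star (1 : A) = 1.
Proof. by have := starM (star (1 : A)) 1; rewrite mulr1 starK mulr1. Qed.

Lemma nrm1 (R : realType) (A : cstarAlgType R) : nrm (1 : A) = 1.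
Proof.
have := nrm_star_mul (1 : A); rewrite star1 mulr1 expr2 => h.
have n0 : nrm (1 : A) != 0 by rewrite nrm_eq0 oner_neq0.
by apply: (mulfI n0); rewrite -h mulr1.
Qed.

Lemma nrmX (R : realType) (A : cstarAlgType R) (a : A) n :
  nrm (a ^+ n) <= nrm a ^+ n.
Proof.
elim: n => [|n IH]; first by rewrite !expr0 nrm1.
by rewrite !exprS (le_trans (nrmM _ _))// ler_wpM2l ?nrm_ge0.
Qed.

Lemma nrm_alg (R : realType) (A : cstarAlgType R) (c : R[i]) :
  nrm (c%:A : A) = normc c.
Proof. by rewrite nrmZ nrm1 mulr1. Qed.

(** The $C^*$ identity gives [nrm b ^+ 2 <= nrm (star b) * nrm b]; cancel [nrm b], then exchange [b]
    and [star b]. *)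
Lemma nrm_star (R : realType) (A : cstarAlgType R) (a : A) :
  nrm (star a) = nrm a.
Proof.
have H (b : A) : nrm b <= nrm (star b).
  have [->|b0] := eqVneq b 0; first by rewrite nrm0 nrm_ge0.
  rewrite -(@ler_pM2r _ (nrm b)) ?nrm_gt0// -expr2 -nrm_star_mul.
  exact: nrmM.
by apply/eqP; rewrite eq_le H -{2}(starK a) H.
Qed.

(** * Invertible elements and the Neumann series *)

Lemma invertible1 (A : pzRingType) : invertible (1 : A).
Proof. by exists 1; rewrite mulr1. Qed.

Lemma invertibleM (A : pzRingType) (a b : A) :
  invertible a -> invertible b -> invertible (a * b).
Proof.
move=> [a' [aa a'a]] [b' [bb b'b]]; exists (b' * a'); split.
  by rewrite mulrA -(mulrA a) bb mulr1.
by rewrite mulrA -(mulrA b') a'a mulr1.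
Qed.

Lemma invertible_lr (A : pzRingType) (a x y : A) :
  a * x = 1 -> y * a = 1 -> invertible a.
Proof.
move=> ax ya; exists x; split => //.
by rewrite -[x]mul1r -ya -(mulrA y) ax mulr1 ya.
Qed.

Lemma invertibleM_comm (A : pzRingType) (a b : A) : a * b = b * a ->
  invertible (a * b) -> invertible a.
Proof.
move=> ab [c [abc cab]]; apply: (@invertible_lr _ _ (b * c) (c * b)).
  by rewrite mulrA.
by rewrite -mulrA -ab.
Qed.

Lemma invertible_alg (R : realType) (A : cstarAlgType R) (c : R[i]) :
  c != 0 -> invertible (c%:A : A).
Proof.
move=> c0; exists (c^-1%:A).
by rewrite !mulr_algl !scalerA mulfV ?mulVf ?scale1r.
Qed.

Lemma cstar_cauchy_cvg (R : realType) (A : cstarAlgType R) (u : nat -> A) :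
  (forall e : R, 0 < e -> exists n, forall m, (n <= m)%N ->
     nrm (u m - u n) < e) ->
  exists l : A, forall e : R, 0 < e -> exists n, forall m, (n <= m)%N ->
     nrm (u m - l) < e.
Proof.
move=> uc.
have /cauchy_cvgP/cvg_ex[l ul] : cauchy (u @ \oo).
  apply: cauchy_exP => e e0.
  have eE : e = ((complex.Re e)%:C)%C by rewrite RRe_real // gtr0_real.
  have [|n un] := uc (complex.Re e); first by rewrite -ltcR -eE.
  exists (u n); exists n => // m /= nm.
  by rewrite -ball_normE/= distrC nrmE eE ltcR un.
exists l => e e0.
have /cvgrPdist_lt/(_ (e%:C)%C) := ul.
rewrite ltcR => /(_ e0)[n _ un]; exists n => m nm.
by have := un m nm; rewrite distrC nrmE ltcR.
Qed.

Lemma small_expr (R : realType) (q e : R) : 0 <= q -> q < 1 -> 0 < e ->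
  exists n, q ^+ n < e.
Proof.
move=> q0 q1 e0; have : q ^+ n @[n --> \oo] --> 0.
  by apply: cvg_expr; rewrite ger0_norm.
move=> /cvgrPdist_lt/(_ _ e0)[n _ /(_ n (leqnn n))] /=.
by rewrite sub0r normrN ger0_norm ?exprn_ge0//; exists n.
Qed.

Lemma neumann (R : realType) (A : cstarAlgType R) (x : A) :
  nrm x < 1 -> invertible (1 - x).
Proof.
move=> x1; pose u n := \sum_(i < n) x ^+ i.
have q0 := nrm_ge0 x.
have xu n : (1 - x) * u n = 1 - x ^+ n.
  by rewrite /u -[RHS]opprB subrX1 -mulNr opprB.
have ux n : u n * (1 - x) = 1 - x ^+ n.
  rewrite -xu; apply: commr_sym; apply: commr_sum => i _.
  by apply: commrX; apply: commr_sym; apply: commrB => //; exact: commr1.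
(* Geometric tail bound, multiplied by [1 - nrm x] so that the induction on [n - m] needs no
   division. *)
have ud m n : (m <= n)%N ->
    nrm (u n - u m) * (1 - nrm x) <= nrm x ^+ m - nrm x ^+ n.
  move=> /subnKC <-; elim: (n - m)%N => [|k IH].
    by rewrite addn0 !subrr nrm0 mul0r.
  rewrite addnS {1}/u big_ord_recr/= -/(u _) addrAC.
  have := nrmX x (m + k); have := nrmD (u (m + k)%N - u m) (x ^+ (m + k)).
  rewrite exprS; move: (nrm _) (nrm (u _ - _)) (nrm x) (nrm (x ^+ _)) IH q0 x1.
  by move=> a b q c; move: (q ^+ _) (q ^+ _) => v w; nra.
have small (e : R) : 0 < e -> exists n, forall m, (n <= m)%N -> nrm x ^+ m < e.
  move=> /(small_expr q0 x1)[n ne]; exists n => m nm.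
  by rewrite (le_lt_trans _ ne)// ler_wiXn2l// ltW.
have [|l ul] := @cstar_cauchy_cvg _ _ u.
  move=> e e0; have e1 : 0 < e * (1 - nrm x) by rewrite mulr_gt0// subr_gt0.
  have [n ne] := small _ e1; exists n => m nm.
  rewrite -(@ltr_pM2r _ (1 - nrm x)) ?subr_gt0//.
  rewrite (le_lt_trans (ud _ _ nm))// (le_lt_trans _ (ne _ (leqnn n)))//.
  by rewrite gerBl exprn_ge0.
have lim0 (b : A) : (forall e, 0 < e -> nrm b <= e) -> b = 0.
  move=> be; apply: nrm0_eq0; apply/eqP; rewrite eq_le nrm_ge0 andbT.
  by apply/ler_addgt0Pr => e /be; rewrite add0r.
have key (e : R) : 0 < e -> exists n, nrm (u n - l) * 2 <= e / 2 /\
    nrm (x ^+ n) <= e / 2.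
  move=> e0; have e4 : 0 < e / 4 by rewrite divr_gt0.
  have e2 : 0 < e / 2 by rewrite divr_gt0.
  have [n1 h1] := ul _ e4; have [n2 h2] := small _ e2.
  exists (maxn n1 n2); split.
    by have := h1 _ (leq_maxl n1 n2); lra.
  exact: le_trans (nrmX _ _) (ltW (h2 _ (leq_maxr n1 n2))).
have n1x : nrm (1 - x) <= 2.
  by have := nrmD 1 (- x); rewrite nrm1 nrmN; lra.
exists l; split; apply/subr0_eq; apply: lim0 => e /key[n [k1 k2]].
- have -> : (1 - x) * l - 1 = (1 - x) * (l - u n) - x ^+ n.
    by rewrite mulrBr xu opprB -addrA [x ^+ n - 1 - _]addrAC subrr sub0r.
  rewrite (le_trans (nrmD _ _))// nrmN (splitr e) lerD//.
  rewrite (le_trans _ k1)// (le_trans (nrmM _ _))// nrmC mulrC.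
  by rewrite ler_wpM2l ?nrm_ge0.
- have -> : l * (1 - x) - 1 = (l - u n) * (1 - x) - x ^+ n.
    by rewrite mulrBl ux opprB -addrA [x ^+ n - 1 - _]addrAC subrr sub0r.
  rewrite (le_trans (nrmD _ _))// nrmN (splitr e) lerD//.
  rewrite (le_trans _ k1)// (le_trans (nrmM _ _))// nrmC.
  by rewrite ler_wpM2l ?nrm_ge0.
Qed.

(** Factoring out [a] leaves [1 + b * d], which the Neumann series inverts. *)
Lemma invertible_perturb (R : realType) (A : cstarAlgType R) (a b d : A) :
  b * a = 1 -> a * b = 1 -> nrm b * nrm d < 1 -> invertible (a + d).
Proof.
move=> ba ab bd; have -> : a + d = a * (1 - b * - d).
  by rewrite mulrN opprK mulrDr mulr1 mulrA ab mul1r.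
apply: invertibleM; first by exists b.
by apply: neumann; rewrite (le_lt_trans (nrmM _ _))// nrmN.
Qed.

(** * The modulus of complex numbers *)

Lemma normc_le (R : realType) (x y : R) :
  normc (x +i* y)%C <= `|x| + `|y|.
Proof.
rewrite /= -[leRHS]ger0_norm ?addr_ge0// -sqrtr_sqr ler_wsqrtr//.
rewrite sqrrD -[x ^+ 2]real_normK ?num_real// -[y ^+ 2]real_normK ?num_real//.
by rewrite addrAC lerDl mulrn_wge0// mulr_ge0.
Qed.

Lemma normc_Re (R : realType) (x y : R) : `|x| <= normc (x +i* y)%C.
Proof. by rewrite /= -sqrtr_sqr ler_wsqrtr// lerDl sqr_ge0. Qed.

Lemma normc_Im (R : realType) (x y : R) : `|y| <= normc (x +i* y)%C.
Proof. by rewrite /= -sqrtr_sqr ler_wsqrtr// lerDr sqr_ge0. Qed.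

Lemma normc_ge0 (R : realType) (z : R[i]) : 0 <= normc z.
Proof. by case: z => x y; rewrite sqrtr_ge0. Qed.

Lemma normcR (R : realType) (x : R) : normc (x%:C)%C = `|x|.
Proof. by rewrite /= expr0n addr0 sqrtr_sqr. Qed.

Lemma normcX (R : realType) (z : R[i]) n : normc (z ^+ n) = normc z ^+ n.
Proof.
by elim: n => [|n IH]; rewrite ?expr0 ?normc1// !exprS normcM IH.
Qed.

(** * Bounded resolvents and Rickart's argument *)

(** Here [g = h - h * d * g], and the last term has norm at most half of [nrm g]. *)
Lemma inverse_perturb_le (R : realType) (A : cstarAlgType R) (a d g h : A) :
  h * a = 1 -> (a + d) * g = 1 -> nrm h * nrm d <= 2^-1 -> nrm g <= 2 * nrm h.
Proof.
move=> ha adg hd; have gE : g = h - h * d * g.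
  have hE : h = g + h * d * g.
    by rewrite -{1}[h]mulr1 -adg mulrA mulrDr ha mulrDl mul1r.
  by rewrite {1}hE addrK.
have : nrm g <= nrm h + nrm h * nrm d * nrm g.
  rewrite {1}gE (le_trans (nrmD _ _))// nrmN lerD2l (le_trans (nrmM _ _))//.
  by rewrite ler_wpM2r ?nrm_ge0// nrmM.
by have := nrm_ge0 g; move: (nrm g) (_ * _) hd => u v; nra.
Qed.

(** Near each point of the square the inverse is at most twice as large as at that point;
    compactness makes the bound uniform. The square is a product of segments and contains the closed
    unit disc. *)
Lemma bounded_resolvent (R : realType) (A : cstarAlgType R) (b : A) :
  (forall x y : R, -1 <= x <= 1 -> -1 <= y <= 1 ->
    invertible (1 - (x +i* y)%C *: b)) ->
  exists2 M : R, 0 < M & forall (x y : R) (g : A),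
    -1 <= x <= 1 -> -1 <= y <= 1 ->
    (1 - (x +i* y)%C *: b) * g = 1 -> nrm g <= M.
Proof.
move=> inv; pose I1 := [set` `[(-1 : R), 1]].
have /compact_near_coveringP K : compact (I1 `*` I1).
  by apply: compact_setX; exact: segment_compact.
pose P (M : R) (p : R * R) := forall g, (1 - (p.1 +i* p.2)%C *: b) * g = 1 ->
  nrm g <= M.
have [[x y] [/= + +]|M [_ MP]] := K _ (pinfty_nbhs R) P _.
- rewrite /I1 /= !in_itv/= => xI yI; have [h [_ hb]] := inv x y xI yI.
  have D0 : 0 < nrm h * nrm b * 4 + 1.
    by rewrite ltr_wpDl// !mulr_ge0// nrm_ge0.
  (* Points of the ball lie within [2 * e] of its centre in modulus, and
     [2 * e * nrm h * nrm b <= 1/2]. *)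
  pose e := (nrm h * nrm b * 4 + 1)^-1.
  have e0 : 0 < e by rewrite invr_gt0.
  exists (ball (x, y) e, [set M | 2 * nrm h < M]).
    split; first exact: nbhsx_ballx.
    by exists (2 * nrm h); split; rewrite ?num_real.
  move=> [[x' y'] M] [/= [/= bx by'] hM] g hg; apply: le_trans (ltW hM).
  pose d := ((x +i* y)%C - (x' +i* y')%C) *: b.
  apply: (inverse_perturb_le (d := d) hb); rewrite /d.
  - by rewrite scalerBl addrA subrK.
  - rewrite nrmZ; have : normc ((x +i* y)%C - (x' +i* y')%C) <= 2 * e.
      rewrite (le_trans (normc_le _ _))// mulr_natl mulr2n.
      by rewrite lerD// ltW.
    have : e * (nrm h * nrm b * 4 + 1) = 1 by rewrite mulVf// lt0r_neq0.
    move: (nrm_ge0 h) (nrm_ge0 b) (normc_ge0 ((x +i* y)%C - (x' +i* y')%C)).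
    rewrite mulrCA; move: (nrm h) (nrm b) (normc _) => u v c u0 v0 c0 eE ce.
    have : c * (u * v) <= 2 * e * (u * v) by rewrite ler_wpM2r ?mulr_ge0.
    by lra.
- exists (Num.max M 0 + 1).
    by rewrite ltr_wpDl// le_max lexx orbT.
  move=> x' y' g xI yI; apply: (MP _ _ (x', y')) => //=.
    by rewrite (@le_lt_trans _ _ (Num.max M 0)) ?ltrDl// le_max lexx.
Qed.

Lemma dyadic_root_N1 (R : realType) k :
  exists2 z : R[i], normc z = 1 & z ^+ (2 ^ k) = -1.
Proof.
have k0 : (0 < 2 ^ k)%N by rewrite expn_gt0.
have zE := rootCK k0 (-1 : R[i]); exists ((2 ^ k).-root (-1)) => //.
apply/eqP; rewrite -(pexpr_eq1 k0) ?normc_ge0// -normcX zE.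
by rewrite /= !oppr0 expr0n/= addr0 sqrrN expr1n sqrtr1.
Qed.

Lemma inverse_unique (A : pzRingType) (a g h : A) :
  invertible a -> a * g = 1 -> a * h = 1 -> g = h.
Proof.
by move=> [c [_ ca]] ag ah; rewrite -[g]mul1r -[h]mul1r -ca -!mulrA ag ah.
Qed.

(** Partial fractions: [1/(1 - x^2)] is the mean of [1/(1 - x)] and [1/(1 + x)]. *)
Lemma inverse_1Bsqr (K : numFieldType) (A : algType K) (x g1 g2 g : A) :
  (1 - x) * g1 = 1 -> g1 * (1 - x) = 1 -> (1 + x) * g2 = 1 ->
  g2 * (1 + x) = 1 -> (1 - x ^+ 2) * g = 1 -> g = 2^-1 *: (g1 + g2).
Proof.
move=> a1 a1' a2 a2' xg.
have xE : 1 - x ^+ 2 = (1 - x) * (1 + x).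
  by rewrite mulrDr mulr1 mulrBl mul1r expr2 addrA subrK.
have gE : g = g2 * g1.
  apply: (@inverse_unique _ (1 - x ^+ 2)) => //; rewrite xE.
    by apply: invertibleM; [exists g1 | exists g2].
  by rewrite mulrA -(mulrA (1 - x)) a2 mulr1.
have -> : g1 + g2 = g2 * ((1 - x) + (1 + x)) * g1.
  by rewrite mulrDr mulrDl a2' mul1r -mulrA a1 mulr1 addrC.
have -> : 1 - x + (1 + x) = 2%:A by rewrite addrACA addNr addr0 scaler_nat.
by rewrite mulr_algr -scalerAl scalerA mulVf ?pnatr_eq0// scale1r gE.
Qed.

(* [(1 - (z b)^(2^k))^-1] is the average of [(1 - w z b)^-1] over the [2^k]-th
   roots of unity [w], whence a Lipschitz constant independent of [k]. *)
Lemma dyadic_inverses (R : realType) (A : cstarAlgType R) (b : A) (L : R) :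
  (forall z : R[i], normc z <= 1 -> invertible (1 - z *: b)) ->
  (forall (u : R[i]) (r s : R) (g h : A), normc u = 1 -> 0 <= r <= 1 ->
    0 <= s <= 1 -> (1 - (r%:C%C * u) *: b) * g = 1 ->
    (1 - (s%:C%C * u) *: b) * h = 1 -> nrm (g - h) <= L * `|r - s|) ->
  forall k,
  (forall z : R[i], normc z <= 1 -> invertible (1 - (z *: b) ^+ (2 ^ k))) /\
  (forall (u : R[i]) (r s : R) (g h : A), normc u = 1 -> 0 <= r <= 1 ->
    0 <= s <= 1 -> (1 - ((r%:C%C * u) *: b) ^+ (2 ^ k)) * g = 1 ->
    (1 - ((s%:C%C * u) *: b) ^+ (2 ^ k)) * h = 1 ->
    nrm (g - h) <= L * `|r - s|).
Proof.
move=> H1 H2; elim=> [|k [IH1 IH2]].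
  by rewrite expn0; split=> [z z1|u r s g h u1 r1 s1]; rewrite !expr1;
    [exact: H1 | exact: H2].
(* As [w ^+ (2 ^ k) = -1], passing from [z] to [w * z] turns [1 - (z b)^(2^k)] into
   [1 + (z b)^(2^k)]. Both factors at the next exponent thus fall under the induction hypothesis,
   and averaging keeps [L]. *)
have [w w1 wk] := dyadic_root_N1 R k.
have NE z : 1 + (z *: b) ^+ (2 ^ k) = 1 - ((w * z) *: b) ^+ (2 ^ k).
  by rewrite !exprZn exprMn wk mulN1r scaleNr opprK.
have wz z : normc (w * z) = normc z by rewrite normcM w1 mul1r.
rewrite expnSr; split=> [z z1|u r s g h u1 r1 s1]; rewrite !exprM.
  have -> : 1 - ((z *: b) ^+ (2 ^ k)) ^+ 2 =
      (1 - (z *: b) ^+ (2 ^ k)) * (1 + (z *: b) ^+ (2 ^ k)).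
    by rewrite mulrDr mulr1 mulrBl mul1r expr2 addrA subrK.
  by apply: invertibleM; rewrite ?NE; apply: IH1 => //; rewrite wz.
have ru1 (t : R) : 0 <= t <= 1 -> normc (t%:C%C * u) <= 1.
  by rewrite normcM u1 mulr1 normcR => /andP[t0 t1]; rewrite ger0_norm.
have [g1 [g1r g1l]] := IH1 _ (ru1 _ r1).
have [h1 [h1r h1l]] := IH1 _ (ru1 _ s1).
have [|g2 []] := IH1 (w * (r%:C%C * u)); first by rewrite wz ru1.
rewrite -NE => g2r g2l.
have [|h2 []] := IH1 (w * (s%:C%C * u)); first by rewrite wz ru1.
rewrite -NE => h2r h2l.
move=> /(inverse_1Bsqr g1r g1l g2r g2l) -> /(inverse_1Bsqr h1r h1l h2r h2l) ->.
have e1 := IH2 u r s _ _ u1 r1 s1 g1r h1r.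
have e2 : nrm (g2 - h2) <= L * `|r - s|.
  apply: (IH2 (w * u)) => //; first by rewrite normcM w1 u1 mul1r.
    by rewrite mulrCA -NE.
  by rewrite mulrCA -NE.
rewrite -scalerBr nrmZ opprD addrACA normcV.
have -> : normc (2 : R[i]) = 2.
  by rewrite -[2 : R[i]](rmorph_nat (real_complex R)) normcR normr_nat.
by have := nrmD (g1 - h1) (g2 - h2); lra.
Qed.

(** Walk from [0] to [b] through the multiples [(i / m) b]. When a dyadic power [x] is small,
    [(1 - x)^-1] is close to [1]; the Lipschitz constant does not depend on the exponent, so a fixed
    step length carries this over to the next [i]. *)
Lemma small_dyadic_power (R : realType) (A : cstarAlgType R) (b : A) :
  (forall x y : R, -1 <= x <= 1 -> -1 <= y <= 1 ->
    invertible (1 - (x +i* y)%C *: b)) ->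
  exists k, nrm (b ^+ (2 ^ k)) <= 2^-1.
Proof.
move=> inv; have [M M0 MP] := bounded_resolvent inv.
(* The resolvent identity [g - h = g * ((r - s) u b) * h] yields this constant, both inverses being
   bounded by [M]. *)
pose L := M * nrm b * M; have L0 : 0 <= L.
  by rewrite !mulr_ge0 ?nrm_ge0// ltW.
have box (x y : R) : normc (x +i* y)%C <= 1 -> (-1 <= x <= 1) && (-1 <= y <= 1).
  by move=> xy; rewrite -!ler_norml !(le_trans _ xy) ?normc_Re ?normc_Im.
have inv1 z : normc z <= 1 -> invertible (1 - z *: b).
  by case: z => x y /box/andP[xI yI]; exact: inv.
have bnd z g : normc z <= 1 -> (1 - z *: b) * g = 1 -> nrm g <= M.
  by case: z => x y /box/andP[xI yI]; exact: MP.
have /(dyadic_inverses inv1) dy (u : R[i]) (r s : R) (g h : A) : normc u = 1 ->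
    0 <= r <= 1 -> 0 <= s <= 1 -> (1 - (r%:C%C * u) *: b) * g = 1 ->
    (1 - (s%:C%C * u) *: b) * h = 1 -> nrm (g - h) <= L * `|r - s|.
  move=> u1 r1 s1 ag ah.
  have [c [_ ca]] : invertible (1 - (r%:C%C * u) *: b).
    apply: inv1; rewrite normcM u1 mulr1 normcR.
    by case/andP: r1 => r0 r1; rewrite ger0_norm.
  have -> : g - h = g * (((r%:C%C - s%:C%C) * u) *: b) * h.
    have -> : ((r%:C%C - s%:C%C) * u) *: b =
        (1 - (s%:C%C * u) *: b) - (1 - (r%:C%C * u) *: b).
      by rewrite mulrBl scalerBl opprB addrCA [1 - _ - 1]addrAC subrr sub0r.
    rewrite mulrBr mulrBl -[g * _ * h]mulrA ah mulr1.
    have -> : g = c by rewrite -[g]mul1r -ca -mulrA ag mulr1.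
    by rewrite ca mul1r.
  rewrite (le_trans (nrmM _ _))//.
  rewrite (le_trans (ler_wpM2r (nrm_ge0 _) (nrmM _ _)))//.
  rewrite nrmZ normcM u1 mulr1 -rmorphB normcR.
  have nh : nrm h <= M.
    apply: bnd ah; rewrite normcM u1 mulr1 normcR.
    by case/andP: s1 => s0 s1; rewrite ger0_norm.
  have ng : nrm g <= M.
    apply: bnd ag; rewrite normcM u1 mulr1 normcR.
    by case/andP: r1 => r0 r1; rewrite ger0_norm.
  rewrite (_ : L * _ = M * (`|r - s| * nrm b) * M); last by rewrite /L; ring.
  by rewrite !ler_pM ?mulr_ge0 ?nrm_ge0.
(* With [m > 6 L] the inverse changes by at most [1/6] in one step. *)
pose m := (Num.bound (6 * L)).+1.
have m0 : 0 < m%:R :> R by rewrite ltr0n.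
have mL : L * m%:R^-1 <= 6^-1.
  rewrite ler_pdivrMr//; have : 6 * L < m%:R.
    have L6 : 0 <= 6 * L by rewrite mulr_ge0.
    by apply: lt_trans (archi_boundP L6) _; rewrite ltr_nat.
  by lra.
suff H i : (i <= m)%N -> exists k,
    nrm (((i%:R / m%:R)%:C%C *: b) ^+ (2 ^ k)) <= 2^-1.
  have [k] := H _ (leqnn m); rewrite divff ?lt0r_neq0// scale1r.
  by exists k.
elim: i => [|i IH] im.
  by exists 0%N; rewrite mul0r scale0r expn0 expr1 nrm0 invr_ge0.
have [k kP] := IH (ltnW im).
(* Two more squarings improve [1/2] to [1/16], so that [nrm (g - 1) <= 1/15] and
   [nrm (1 - h) <= 1/15 + 1/6 < 1/3]. *)
have [inv2 lip2] := dy (k + 2)%N.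
have in01 (j : nat) : (j <= m)%N -> 0 <= (j%:R / m%:R : R) <= 1.
  by move=> jm; rewrite divr_ge0//= ler_pdivrMr// mul1r ler_nat.
have in1 (j : nat) : (j <= m)%N -> normc ((j%:R / m%:R : R)%:C%C * 1) <= 1.
  move=> jm; have /andP[j0 j1] := in01 _ jm; by rewrite mulr1 normcR ger0_norm.
have [g [ag ga]] := inv2 _ (in1 _ (ltnW im)).
have [h [ah ha]] := inv2 _ (in1 _ im).
have := lip2 1 _ _ _ _ (normc1 R) (in01 _ (ltnW im)) (in01 _ im) ag ah.
have -> : `|i%:R / m%:R - i.+1%:R / m%:R| = m%:R^-1 :> R.
  rewrite -mulrBl -[i.+1]addn1 natrD opprD addrA subrr sub0r mulN1r normrN.
  by rewrite ger0_norm// invr_ge0 ltW.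
move=> gh.
have xs : nrm (((i%:R / m%:R)%:C%C * 1 *: b) ^+ (2 ^ (k + 2))) <= 16^-1.
  rewrite mulr1 expnD exprM.
  apply: le_trans (nrmX _ _) _.
  apply: (@le_trans _ _ (2^-1 ^+ 4)); last by lra.
  by rewrite lerXn2r// ?nnegrE ?nrm_ge0// invr_ge0.
exists (k + 2)%N; rewrite -[_%:C%C]mulr1.
move: xs ag ga ah ha; set x := (_ *: b) ^+ _; set y := (_ *: b) ^+ _.
move=> xs ag ga ah ha.
have gE : g - 1 = x * g by rewrite -ag mulrBl mul1r opprB addrCA subrr addr0.
(* This identity gives [nrm y <= (1 + nrm y) / 3], hence [nrm y <= 1/2]. *)
have yE : - y = (1 - y) * (1 - h).
  by rewrite mulrBr mulr1 ah addrAC subrr sub0r.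
have g1 : nrm (g - 1) <= nrm x * nrm g by rewrite gE nrmM.
have g2 : nrm g <= nrm (g - 1) + 1.
  by have := nrmD (g - 1) 1; rewrite subrK nrm1.
have h1 : nrm (1 - h) <= nrm (g - 1) + L / m%:R.
  have -> : 1 - h = - (g - 1) + (g - h) by rewrite opprB addrA subrK.
  by rewrite (le_trans (nrmD _ _))// nrmN lerD.
have y1 : nrm y <= nrm (1 - y) * nrm (1 - h) by rewrite -nrmN {1}yE nrmM.
have y2 : nrm (1 - y) <= 1 + nrm y.
  by have := nrmD 1 (- y); rewrite nrm1 nrmN.
move: (nrm_ge0 g) (nrm_ge0 x) (nrm_ge0 y) (nrm_ge0 (1 - y)) (nrm_ge0 (1 - h)).
move: g1 g2 h1 y1 y2 xs mL; move: (nrm g) (nrm x) (nrm y) (nrm (1 - y)).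
move: (nrm (1 - h)) (nrm (g - 1)) (L / _) => c e l p q u v.
move=> g1 g2 h1 y1 y2 xs mL p0 q0 u0 v0 c0.
have : q * p <= 16^-1 * p by rewrite ler_wpM2r.
have : v * c <= v * 3^-1 -> u <= 2^-1 by lra.
move=> hc pq. apply: hc; rewrite ler_wpM2l//; lra.
Qed.

(** * Spectra and the spectral radius *)

Lemma invertibleZ (R : realType) (A : cstarAlgType R) (c : R[i]) (a : A) :
  c != 0 -> invertible a -> invertible (c *: a).
Proof.
move=> c0 ai; rewrite -mulr_algl; apply: invertibleM => //.
exact: invertible_alg.
Qed.

Lemma spectrumPn (R : realType) (A : cstarAlgType R) (a : A) (l : R[i]) :
  ~ spectrum a l -> invertible (a - l%:A).
Proof. exact: contrapT. Qed.

Lemma invertible_1Bscale (R : realType) (A : cstarAlgType R) (a : A)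
    (z : R[i]) :
  (z != 0 -> invertible (a - z^-1%:A)) -> invertible (1 - z *: a).
Proof.
have [-> _|z0 /(_ isT) ai] := eqVneq z 0.
  by rewrite scale0r subr0; exact: invertible1.
have -> : 1 - z *: a = - z *: (a - z^-1%:A).
  by rewrite scalerBr scaleNr scalerA mulNr mulfV// scaleN1r opprK addrC.
by apply: invertibleZ; rewrite ?oppr_eq0.
Qed.

Lemma nrm_idem_ge1 (R : realType) (A : cstarAlgType R) (e : A) :
  e * e = e -> e != 0 -> 1 <= nrm e.
Proof.
move=> ee; rewrite -nrm_gt0 => e0; have := nrmM e e.
by rewrite ee -{1}[nrm e]mulr1 ler_pM2l.
Qed.

(* Relative to the splitting [1 = Q + (1 - Q)], [N] is upper triangular with
   diagonal [(0, B)], and [B] is invertible; the statement is that [B] has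
   nonempty spectrum in the corner [(1 - Q) A (1 - Q)]. *)
Lemma corner_spectrum (R : realType) (A : cstarAlgType R) (N Q : A)
    (d : R[i]) :
  d != 0 -> Q * Q = Q -> Q != 1 -> N * Q = 0 -> invertible (N + d *: Q) ->
  exists2 l : R[i], l != 0 & spectrum N l.
Proof.
move=> d0 QQ Q1 NQ [W [VW WV]]; apply: contrapT => noth.
have inv l : l != 0 -> invertible (N - l%:A).
  by move=> l0; apply: spectrumPn => Nl; apply: noth; exists l.
have WQ : d *: (W * Q) = Q.
  have : (N + d *: Q) * Q = d *: Q by rewrite mulrDl NQ add0r -scalerAl QQ.
  by move=> h; rewrite scalerAr -h mulrA WV mul1r.
have Q'Q : (1 - Q) * Q = 0 by rewrite mulrBl mul1r QQ subrr.
(* [U] annihilates [Q] and inverts [N] from the left modulo [Q], so [U ^+ n * N ^+ n = 1 - Q] for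
   all [n > 0]. *)
pose U := (1 - Q) * W.
have UQ : U * Q = 0.
  apply/eqP; have : d *: (U * Q) == 0 by rewrite -mulrA scalerAr WQ Q'Q.
  by rewrite scaler_eq0 (negPf d0).
have UN : U * N = 1 - Q.
  have : U * (N + d *: Q) = 1 - Q by rewrite -mulrA WV mulr1.
  by rewrite mulrDr -scalerAr UQ scaler0 addr0.
have UUN n : U ^+ n.+1 * N ^+ n.+1 = 1 - Q.
  elim: n => [|n IH]; first by rewrite !expr1.
  rewrite (exprSr U) (exprS N) mulrA -(mulrA _ U N) UN mulrBr mulr1.
  by rewrite [_ * Q](_ : _ = 0) ?subr0// exprSr -mulrA UQ mulr0.
(* If the spectrum lies in [{0}], so does that of every multiple, and some power of [K N] has norm
   at most [1/2]. As [K] exceeds [nrm U], that norm bounds the norm of the nonzero idempotent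
   [1 - Q], which is at least [1]. *)
pose K := nrm U + 1; have K0 : 0 < K by rewrite ltr_wpDl// nrm_ge0.
have [|k kP] := @small_dyadic_power _ _ (K%:C%C *: N).
  move=> x y _ _; rewrite scalerA; apply: invertible_1Bscale => z0.
  by apply: inv; rewrite invr_eq0.
have := expn_gt0 2 k; case: (2 ^ k)%N kP => // n; rewrite exprZn nrmZ normcX.
rewrite normcR (ger0_norm (ltW K0)) => kP _.
have : 1 <= nrm (1 - Q).
  apply: nrm_idem_ge1; last by rewrite subr_eq0 eq_sym.
  by rewrite mulrBr mulr1 Q'Q subr0.
apply/negP; rewrite -ltNge; apply: (@le_lt_trans _ _ 2^-1); last by lra.
apply: le_trans kP; rewrite -(UUN n) (le_trans (nrmM _ _))//.
rewrite ler_wpM2r ?nrm_ge0// (le_trans (nrmX _ _))//.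
by rewrite lerXn2r// ?nnegrE ?nrm_ge0 ?(ltW K0)// lerDl.
Qed.

(** For invertible [a] this is [corner_spectrum] with [Q = 0] and [d = 1]; otherwise [0] is a
    spectral value. *)
Lemma spectrum_nonempty (R : realType) (A : cstarAlgType R) (a : A) :
  exists l, spectrum a l.
Proof.
have [ai|] := pselect (invertible a); last first.
  by move=> ai; exists 0; rewrite /spectrum/= scale0r subr0.
have [|||||l _] := @corner_spectrum _ _ a 0 1; last by exists l.
- exact: oner_neq0.
- by rewrite mulr0.
- by rewrite eq_sym oner_neq0.
- by rewrite mulr0.
- by rewrite scaler0 addr0.
Qed.

Lemma spectrum_le (R : realType) (A : cstarAlgType R) (a : A) (l : R[i]) :
  spectrum a l -> normc l <= nrm a.
Proof.
move=> al; rewrite leNgt; apply/negP => la; apply: al.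
have l0 : l != 0.
  by apply/eqP => l0; move: la; rewrite l0 normc0 ltNge nrm_ge0.
have -> : a - l%:A = - l *: (1 - l^-1 *: a).
  by rewrite scalerBr scalerA mulNr mulfV// scaleN1r opprK scaleNr addrC.
apply: invertibleZ; rewrite ?oppr_eq0//; apply: neumann.
rewrite nrmZ normcV ltr_pdivrMl ?mulr1//.
exact: le_lt_trans (nrm_ge0 _) la.
Qed.

Lemma nrm_dyadic_power (R : realType) (A : cstarAlgType R) (h : A) k :
  self_adjoint h -> nrm (h ^+ (2 ^ k)) = nrm h ^+ (2 ^ k).
Proof.
move=> hs; elim: k => [|k IH]; first by rewrite expn0 !expr1.
have hks n : star (h ^+ n) = h ^+ n.
  elim: n => [|n IHn]; first by rewrite expr0 star1.
  by rewrite {1}exprSr starM IHn (hs : star h = h) -exprS.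
by rewrite expnSr !exprM -IH -nrm_star_mul hks.
Qed.

(** Arens' trick: shifting [h] by [i t] and applying the $C^*$ identity gives
    [|l + i t|^2 <= nrm h ^+ 2 + t ^+ 2] for all real [t]. *)
Lemma self_adjoint_spectrum_real (R : realType) (A : cstarAlgType R) (h : A)
    (l : R[i]) :
  self_adjoint h -> spectrum h l -> l \is Num.real.
Proof.
move=> hs; case: l => x y hl; rewrite complex_real; apply/eqP.
have star_i (t : R) : star (h + (0 +i* t)%C%:A) = h - (0 +i* t)%C%:A.
  rewrite starD (hs : star h = h) starZ star1 -scaleNr; congr (_ + _ *: _).
  by apply/eqP; rewrite eq_complex/= oppr0 !eqxx.
have le_t (t : R) : x ^+ 2 + (y + t) ^+ 2 <= nrm h ^+ 2 + t ^+ 2.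
  have [c cE] : exists c : R[i], c = (0 +i* t)%C by exists (0 +i* t)%C.
  have /spectrum_le hl' : spectrum (h + c%:A) ((x +i* y)%C + c).
    by move: hl; rewrite /spectrum/= scalerDl opprD addrACA subrr addr0.
  have := nrm_star_mul (h + c%:A); rewrite {1}cE star_i -cE.
  have -> : (h - c%:A) * (h + c%:A) = h ^+ 2 - (c ^+ 2)%:A.
    rewrite mulrDr !mulrBl !mulr_algr !mulr_algl scalerA !expr2.
    by rewrite addrA subrK.
  move=> E; have : normc ((x +i* y)%C + c) ^+ 2 <= nrm (h + c%:A) ^+ 2.
    by rewrite lerXn2r// ?nnegrE ?nrm_ge0 ?normc_ge0.
  rewrite -E cE /= addr0 sqr_sqrtr ?addr_ge0 ?sqr_ge0// => /le_trans; apply.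
  rewrite (le_trans (nrmD _ _))// lerD//; first exact: nrmX.
  by rewrite nrmN nrm_alg normcX /= expr0n add0r sqrtr_sqr real_normK ?num_real.
apply/eqP; rewrite -sqrf_eq0 eq_le sqr_ge0 andbT; apply/negPn/negP => y0.
have y1 : y != 0 by apply: contraNneq y0 => ->; rewrite expr0n.
(* This [t] makes the cross term [2 y t] equal to [2 nrm h ^+ 2], which would force
   [x^2 + y^2 + nrm h ^+ 2 <= 0]. *)
have := le_t (nrm h ^+ 2 / y).
rewrite sqrrD addrA -mulr_natl.
have -> : y * (nrm h ^+ 2 / y) = nrm h ^+ 2 by rewrite mulrC divfK.
have := sqr_ge0 x; have := sqr_ge0 (nrm h).
have : 0 < y ^+ 2 by rewrite lt_neqAle sqr_ge0 eq_sym sqrf_eq0 y1.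
by lra.
Qed.

(** If all spectral values were smaller, some dyadic power of [h / nrm h] would have norm at most
    [1/2], whereas the $C^*$ identity makes it [1]. *)
Lemma self_adjoint_radius (R : realType) (A : cstarAlgType R) (h : A) :
  self_adjoint h -> exists2 l, spectrum h l & nrm h <= normc l.
Proof.
move=> hs; have [->|h0] := eqVneq h 0.
  have [l l0] := spectrum_nonempty (0 : A).
  by exists l => //; rewrite nrm0 normc_ge0.
have n0 : 0 < nrm h by rewrite nrm_gt0.
apply: contrapT => noth.
have inv l : nrm h <= normc l -> invertible (h - l%:A).
  by move=> l0; apply: spectrumPn => Nl; apply: noth; exists l.
have [|k] := @small_dyadic_power _ _ ((nrm h)^-1%:C%C *: h).
  move=> x y xI _; rewrite scalerA; apply: invertible_1Bscale.
  set z := _ * _ => z0; apply: spectrumPn => hz.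
  (* The square reaches beyond the unit disc, but the spectrum of [h] is real, so only real points
     of the square matter, and these lie in the disc. *)
  have zr : z \is Num.real.
    by rewrite -[z]invrK rpredV; exact: self_adjoint_spectrum_real hz.
  have xyE : (x +i* y)%C = z * (nrm h)%:C%C.
    by rewrite /z -mulrA -rmorphM/= mulVf ?lt0r_neq0// mulr1.
  have y0 : y = 0.
    apply/eqP; rewrite -(complex_real x y) xyE rpredM//.
    by rewrite complex_real.
  apply: hz; apply: inv; rewrite normcV /z normcM y0 normcR normcR.
  rewrite (ger0_norm (_ : 0 <= (nrm h)^-1)) ?invr_ge0 ?(ltW n0)// invfM invrK.
  rewrite ler_peMl ?(ltW n0)// invf_ge1 ?ler_norml// normr_gt0.
  apply: contraNneq z0 => x0; rewrite /z x0 y0.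
  by rewrite (_ : (0 +i* 0)%C = 0) ?mul0r.
rewrite exprZn nrmZ normcX normcR ger0_norm ?invr_ge0 ?(ltW n0)//.
rewrite nrm_dyadic_power// -exprMn mulVf ?lt0r_neq0// expr1n.
by lra.
Qed.

(** * Polynomial calculus and spectral projections *)

(** [f - l] splits into linear factors over [R[i]]; if no root were a spectral value, every factor
    would be invertible at [a]. *)
Lemma spectral_mapping (R : realType) (A : cstarAlgType R) (a : A)
    (f : {poly R[i]}) (l : R[i]) :
  spectrum (horner_alg a f) l -> exists2 m, spectrum a m & f.[m] = l.
Proof.
move=> fl; have [f0|f0] := eqVneq (f - l%:P) 0.
  have [m am] := spectrum_nonempty a; exists m => //.
  by rewrite (subr0_eq f0) hornerC.
have [rs fE] := closed_field_poly_normal (f - l%:P).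
apply: contrapT => noth; apply: fl.
rewrite -(horner_algC a) -rmorphB fE -mul_polyC rmorphM/= horner_algC mulr_algl.
apply: invertibleZ; first by rewrite lead_coef_eq0.
have : forall z, z \in rs -> invertible (a - z%:A).
  move=> z zrs; apply: spectrumPn => az; apply: noth; exists z => //.
  apply/eqP; rewrite -subr_eq0 -[X in _ - X](hornerC l z) -hornerN -hornerD fE.
  by rewrite hornerZ mulf_eq0; apply/orP; right; rewrite -rootE root_prod_XsubC.
elim: rs {fE} => [|z rs IH] zi.
  by rewrite big_nil rmorph1; exact: invertible1.
rewrite big_cons rmorphM/=; apply: invertibleM.
  by rewrite rmorphB/= horner_algX horner_algC; apply: zi; rewrite mem_head.
by apply: IH => w wrs; apply: zi; rewrite in_cons wrs orbT.
Qed.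

Lemma star0 (R : realType) (A : cstarAlgType R) : star (0 : A) = 0.
Proof. by apply: (addrI (star 0)); rewrite -starD !addr0. Qed.

Lemma star_real (R : realType) (A : cstarAlgType R) (c : R[i]) (a : A) :
  c \is Num.real -> star (c *: a) = c *: star a.
Proof. by move=> cr; rewrite starZ conj_Creal. Qed.

Lemma self_adjoint_horner (R : realType) (A : cstarAlgType R) (a : A)
    (f : {poly R[i]}) :
  self_adjoint a -> f \is a polyOver (@Num.Def.real_num_pred R[i]) ->
  self_adjoint (horner_alg a f).
Proof.
move=> sa /polyOverP fr; rewrite /self_adjoint/= -[f]coefK poly_def.
rewrite raddf_sum/= (big_morph _ (@starD _ A) (star0 A)).
apply: eq_bigr => i _; rewrite -mul_polyC rmorphM/= horner_algC mulr_algl.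
rewrite rmorphXn/= horner_algX star_real//.
congr (_ *: _); elim: (nat_of_ord i) => [|n IH]; first by rewrite expr0 star1.
by rewrite {1}exprSr starM IH (sa : star a = a) -exprS.
Qed.

(** Real coefficients keep [f(a)] self-adjoint, so its norm is bounded by a spectral value, and
    spectral mapping makes that value [0]. *)
Lemma horner_alg_eq0 (R : realType) (A : cstarAlgType R) (a : A)
    (f : {poly R[i]}) :
  self_adjoint a -> f \is a polyOver (@Num.Def.real_num_pred R[i]) ->
  (forall m, spectrum a m -> f.[m] = 0) -> horner_alg a f = 0.
Proof.
move=> sa fr f0.
have [l /spectral_mapping[m am <-]] :=
  self_adjoint_radius (self_adjoint_horner sa fr).
rewrite f0// normc0 => n0; apply: nrm0_eq0; apply/eqP.
by rewrite eq_le n0 nrm_ge0.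
Qed.

Lemma spectral_projection (R : realType) (A : cstarAlgType R) (a : A)
    (l : R[i]) :
  self_adjoint a -> finite_set (spectrum a) -> spectrum a l ->
  exists E : A, [/\ self_adjoint E, E * E = E, E != 0 & a * E = l *: E].
Proof.
move=> sa /finite_seqP[s sE] al.
have sreal m : spectrum a m -> m \is Num.real.
  by exact: self_adjoint_spectrum_real.
(* A polynomial of Lagrange type: zero at the other spectral values and nonzero at [l]. Its
   coefficients are real because the spectrum is. *)
pose q := \prod_(m <- s | m != l) ('X - m%:P).
have qr : q \is a polyOver (@Num.Def.real_num_pred R[i]).
  rewrite /q big_seq_cond; apply: rpred_prod => m /andP[ms _].
  by rewrite polyOverXsubC; apply: sreal; rewrite sE.
have q0 m : spectrum a m -> m != l -> q.[m] = 0.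
  rewrite sE /= => ms ml; rewrite /q -big_filter; apply/rootP.
  by rewrite root_prod_XsubC mem_filter ml.
have ql : q.[l] != 0.
  rewrite /q -big_filter -rootE root_prod_XsubC mem_filter negb_and eqxx.
  by [].
have qlr : q.[l] \is Num.real.
  by apply: rpred_horner => //; exact: sreal.
have aq : a * horner_alg a q = l *: horner_alg a q.
  apply/subr0_eq; have : horner_alg a (('X - l%:P) * q) = 0.
    apply: horner_alg_eq0 => //.
      by rewrite rpredM// polyOverXsubC; exact: sreal.
    move=> m am; rewrite hornerM hornerXsubC.
    by have [->|ml] := eqVneq m l; rewrite ?subrr ?mul0r// q0// mulr0.
  by rewrite rmorphM/= rmorphB/= horner_algX horner_algC mulrBl mulr_algl.
(* Taking [f = q] makes [q(a) / q.[l]] idempotent. *)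
have fq f : horner_alg a f * horner_alg a q = f.[l] *: horner_alg a q.
  elim/poly_ind: f => [|f c IH]; first by rewrite horner0 rmorph0 mul0r scale0r.
  rewrite hornerMXaddC rmorphD rmorphM/= horner_algX horner_algC mulrDl.
  by rewrite mulr_algl -mulrA aq -scalerAr IH scalerA scalerDl [l * _]mulrC.
have qn0 : horner_alg a q != 0.
  (* If [q(a) = 0], the quotient of [q - q.[l]] by [X - l] gives an inverse of [a - l] up to a
     nonzero scalar. *)
  apply/eqP => qa0; apply: al.
  have /factor_theorem[r rE] : root (q - q.[l]%:P) l.
    by rewrite rootE hornerD hornerN hornerC subrr.
  have aE : a - l%:A = horner_alg a ('X - l%:P).
    by rewrite rmorphB/= horner_algX horner_algC.
  have comm : (a - l%:A) * horner_alg a r = horner_alg a r * (a - l%:A).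
    by rewrite aE -!rmorphM mulrC.
  apply: (invertibleM_comm comm); rewrite comm aE -rmorphM -rE.
  rewrite rmorphB/= qa0 sub0r horner_algC -scaleNr.
  by apply: invertible_alg; rewrite oppr_eq0.
exists (q.[l]^-1 *: horner_alg a q); split.
- rewrite /self_adjoint/= star_real ?rpredV//.
  by rewrite (self_adjoint_horner sa qr : star _ = _).
- by rewrite -scalerAl -scalerAr fq (scalerA q.[l]^-1 q.[l]) mulVf// scale1r.
- by rewrite scaler_eq0 invr_eq0 negb_or ql.
- by rewrite -scalerAr aq !scalerA mulrC.
Qed.

(** * Projections from real rank zero *)

Lemma real_rank_zero_approx (R : realType) (A : cstarAlgType R) (a : A)
    (e : R) :
  real_rank_zero A -> self_adjoint a -> 0 < e ->
  exists b : A, [/\ self_adjoint b, finite_set (spectrum b) & nrm (a - b) < e].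
Proof.
move=> hRR sa e0; have [|b [[sb fb] ab]] := hRR a sa (ball a (e%:C)%C).
  by apply: nbhsx_ballx; rewrite ltcR.
by exists b; split => //; move: ab; rewrite -ball_normE/= nrmE ltcR.
Qed.

Lemma nrm_projection_le1 (R : realType) (A : cstarAlgType R) (E : A) :
  self_adjoint E -> E * E = E -> nrm E <= 1.
Proof.
move=> sE EE; have := nrm_star_mul E; rewrite (sE : star E = E) EE.
have := nrm_ge0 E; rewrite le_eqVlt => /predU1P[<-//|n0].
by rewrite expr2 -{1}[nrm E]mulr1 => /(mulfI (lt0r_neq0 n0)) <-.
Qed.

Lemma self_adjoint_inverse (R : realType) (A : cstarAlgType R) (a g : A) :
  self_adjoint a -> a * g = 1 -> g * a = 1 -> self_adjoint g.
Proof.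
move=> sa ag ga; apply: (@inverse_unique _ a) => //; first by exists g.
by rewrite -{1}(sa : star a = a) -starM ga star1.
Qed.

Lemma spectrum_inverse (R : realType) (A : cstarAlgType R) (a g : A)
    (m : R[i]) :
  a * g = 1 -> g * a = 1 -> spectrum g m -> m != 0 /\ spectrum a m^-1.
Proof.
move=> ag ga gm; have m0 : m != 0.
  by apply/eqP => m0; apply: gm; rewrite m0 scale0r subr0; exists a.
split=> // ai; apply: gm.
have -> : g - m%:A = - m *: (g * (a - m^-1%:A)).
  rewrite mulrBr ga mulr_algr scalerBr scaleNr scalerA mulNr mulfV//.
  by rewrite scaleN1r opprK addrC.
apply: invertibleZ; rewrite ?oppr_eq0//; apply: invertibleM => //.
by exists a.
Qed.

(** A finite-spectrum approximant [b] of [h] must have a spectral value of modulus at most [e / 2]: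
    otherwise [b] would have an inverse small enough for [h] to be invertible as a perturbation of
    [b]. *)
Lemma small_spectral_projection (R : realType) (A : cstarAlgType R) (h : A)
    (e : R) :
  real_rank_zero A -> self_adjoint h -> ~ invertible h -> 0 < e ->
  exists P : A, [/\ self_adjoint P, P * P = P, P != 0 & nrm (h * P) <= e].
Proof.
move=> hRR sh hn e0; have e2 : 0 < e / 2 by rewrite divr_gt0.
have [b [sb fb hb]] := real_rank_zero_approx hRR sh e2.
have [l bl le2] : exists2 l, spectrum b l & normc l <= e / 2.
  apply: contrapT => noth; apply: hn.
  have [g [bg gb]] : invertible b.
    have -> : b = b - 0%:A by rewrite scale0r subr0.
    apply: spectrumPn => b0; apply: noth; exists 0 => //.
    by rewrite normc0 ltW.
  (* The inverse is self-adjoint, so its norm is controlled by the reciprocal of a spectral value of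
     [b]. *)
  have [m gm mg] := self_adjoint_radius (self_adjoint_inverse sb bg gb).
  have [m0 bm] := spectrum_inverse bg gb gm.
  have nm0 : 0 < normc m.
    rewrite lt_neqAle normc_ge0 andbT eq_sym.
    by apply: contraNneq m0 => /eq0_normc ->.
  have em : e / 2 < normc m^-1.
    by rewrite ltNge; apply/negP => em; apply: noth; exists m^-1.
  rewrite -[h](subrK b) addrC; apply: (invertible_perturb gb bg).
  apply: (@le_lt_trans _ _ (normc m * nrm (h - b))).
    by rewrite ler_wpM2r ?nrm_ge0.
  rewrite -(mulfV (lt0r_neq0 nm0)) ltr_pM2l// -normcV.
  exact: lt_trans hb em.
have [E [sE EE E0 bE]] := spectral_projection sb fb bl.
exists E; split => //; have -> : h * E = (h - b) * E + l *: E.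
  by rewrite -bE -mulrDl subrK.
have E1 := nrm_projection_le1 sE EE.
rewrite (le_trans (nrmD _ _))// [leRHS]splitr lerD//.
  rewrite (le_trans (nrmM _ _))// (le_trans _ (ltW hb))//.
  by rewrite ler_piMr ?nrm_ge0.
by rewrite nrmZ (le_trans _ le2)// ler_piMr ?normc_ge0.
Qed.

Lemma starN (R : realType) (A : cstarAlgType R) (a : A) : star (- a) = - star a.
Proof. by apply: (addrI (star a)); rewrite -starD !subrr star0. Qed.

(** With only [0] and [1] as projections, self-adjoint elements of finite spectrum are scalars,
    hence by density all self-adjoint elements are, hence all elements, through real and imaginary
    parts. *)
Lemma nontrivial_projection (R : realType) (A : cstarAlgType R) :
  real_rank_zero A -> dim_gt A 1 ->
  exists E : A, [/\ self_adjoint E, E * E = E, E != 0 & E != 1].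
Proof.
move=> hRR [v vfree]; apply: contrapT => noth.
have scalar_sa (a : A) : self_adjoint a -> exists l : R[i], a = l%:A.
  move=> sa; have [l al] := spectrum_nonempty a; exists l.
  apply/subr0_eq/nrm0_eq0/eqP; rewrite eq_le nrm_ge0 andbT.
  apply/ler_addgt0Pr => e e0; rewrite add0r.
  have e2 : 0 < e / 2 by rewrite divr_gt0.
  have [b [sb fb ab]] := real_rank_zero_approx hRR sa e2.
  have [m bm] := spectrum_nonempty b.
  have [E [sE EE E0 bE]] := spectral_projection sb fb bm.
  have bE1 : b = m%:A.
    have [E1|E1] := eqVneq E 1; first by move: bE; rewrite E1 mulr1.
    by exfalso; apply: noth; exists E.
  have lm : normc (l - m) <= nrm (a - b).
    apply: spectrum_le; rewrite /spectrum/= scalerBl bE1 => ?; apply: al.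
    by rewrite -[a](subrK m%:A) -addrA -[m%:A - _]opprB.
  have -> : a - l%:A = (a - b) - (l - m)%:A.
    by rewrite scalerBl bE1 opprB addrA subrK.
  rewrite (le_trans (nrmD _ _))// nrmN nrm_alg [leRHS]splitr lerD ?ltW//.
  exact: le_lt_trans lm ab.
have scalar (a : A) : exists l : R[i], a = l%:A.
  have ii : (0 +i* 1)%C * (0 +i* 1)%C = -1 :> R[i] by rewrite -expr2 sqr_i.
  have [|l lE] := scalar_sa (a + star a).
    by rewrite /self_adjoint/= starD starK addrC.
  have [|m mE] := scalar_sa ((0 +i* 1)%C *: (a - star a)).
    rewrite /self_adjoint/= starZ starD starN starK.
    have -> : ((0 +i* 1)%C : R[i])^* = - (0 +i* 1)%C.
      by apply/eqP; rewrite eq_complex/= oppr0 !eqxx.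
    by rewrite scaleNr -scalerN opprB.
  exists (2^-1 * (l - (0 +i* 1)%C * m)).
  rewrite -scalerA scalerBl -lE -scalerA -mE scalerA ii scaleN1r opprK.
  rewrite addrACA subrr addr0 -mulr2n -scalerMnr scalerMnl -mulr_natr.
  by rewrite mulVf ?pnatr_eq0// scale1r.
have [c0 v0] := scalar (v ord0); have [c1 v1] := scalar (v ord_max).
have i01 (i : 'I_2) : i = ord0 \/ i = ord_max.
  by case: i => [[|[|//]] hi]; [left | right]; exact: val_inj.
pose c (x y : R[i]) (i : 'I_2) := if i == ord0 then x else y.
have comb x y : \sum_i c x y i *: v i = (x * c0 + y * c1)%:A.
  by rewrite big_ord_recl big_ord1 /c/= v0 (_ : lift _ _ = ord_max)
    ?v1 ?scalerA ?scalerDl//; exact: val_inj.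
(* The vanishing combination with coefficients [c1] and [- c0] forces [c1 = 0]; then the
   coefficients [0] and [1] contradict independence. *)
have c10 : c1 = 0.
  have := vfree (c c1 (- c0)); rewrite comb mulNr mulrC subrr scale0r.
  by move=> /(_ erefl ord0).
have := vfree (c 0 1); rewrite comb c10 mul0r mulr0 addr0 scale0r.
by move=> /(_ erefl ord_max)/eqP; rewrite /c/= oner_eq0.
Qed.

(** For [y = P x (P x)^*] and [b] close to it with [b E = l E], one has [(l + (y - b)) E = y E];
    inverting the first factor puts [E] in [I]. Since [(1 - P) y = 0], also
    [l (1 - P) E = - (1 - P) (y - b) E], which is small. *)
Lemma essential_ideal_projection (R : realType) (A : cstarAlgType R)
    (I : set A) (P : A) (e : R) :
  real_rank_zero A -> two_sided_ideal I -> essential I ->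
  P * P = P -> P != 0 -> 0 < e ->
  exists E : A,
    [/\ I E, self_adjoint E, E * E = E, E != 0 & nrm ((1 - P) * E) <= e].
Proof.
move=> hRR hI hess PP P0 e0.
have [x Ix Px0] : exists2 x, I x & P * x != 0.
  apply: contrapT => noth; move/eqP: P0; apply; apply: hess.
  apply/seteqP; split => [_ [x Ix <-]|_ ->] /=.
    by apply: contrapT => /eqP Px; apply: noth; exists x.
  by exists 0; [exact: (Defs.ideal0 hI) | rewrite mulr0].
pose y := (P * x) * star (P * x).
have Iy : I y.
  by rewrite /y; apply: (Defs.idealMr hI) => //; exact: (Defs.idealMl hI).
have sy : self_adjoint y by rewrite /self_adjoint/= starM starK.
have Py : P * y = y by rewrite /y !mulrA PP.
have y0 : 0 < nrm y.
  have := nrm_star_mul (star (P * x)); rewrite starK -/y => ->.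
  by rewrite exprn_gt0// nrm_star nrm_gt0.
pose k := nrm (1 - P) + 1.
have k0 : 0 < k by rewrite ltr_wpDl// nrm_ge0.
(* The first bound gives [nrm (y - b) < nrm y / 2 < normc l]; the second gives
   [k * t <= e * normc l]. *)
pose t := Num.min (nrm y / 2) (e * (nrm y / 2) / k).
have t0 : 0 < t.
  by rewrite lt_min !(divr_gt0, mulr_gt0).
have [b [sb fb yb]] := real_rank_zero_approx hRR sy t0.
have [l bl ln] := self_adjoint_radius sb.
have [E [sE EE E0 bE]] := spectral_projection sb fb bl.
have ly : nrm y / 2 < normc l.
  have : nrm y <= nrm (y - b) + nrm b by have := nrmD (y - b) b; rewrite subrK.
  have : t <= nrm y / 2 by rewrite ge_min lexx.
  by lra.
have yl : nrm (y - b) < normc l.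
  by apply: lt_trans ly; rewrite (lt_le_trans yb)// ge_min lexx.
have l0 : 0 < normc l by rewrite (le_lt_trans (nrm_ge0 (y - b))).
have ln0 : l != 0 by apply/eqP => lE; move: l0; rewrite lE normc0 ltxx.
exists E; split => //.
- have [g [_ gE]] : invertible (l%:A + (y - b)).
    apply: (@invertible_perturb _ _ _ (l^-1%:A)).
    + by rewrite mulr_algl scalerA mulVf// scale1r.
    + by rewrite mulr_algl scalerA mulfV// scale1r.
    + by rewrite nrm_alg normcV ltr_pdivrMl// mulr1.
  have -> : E = g * y * E.
    have yE : (l%:A + (y - b)) * E = y * E.
      by rewrite mulrDl mulr_algl -bE -mulrDl addrC subrK.
    by rewrite -mulrA -yE mulrA gE mul1r.
  by apply: (Defs.idealMr hI) => //; exact: (Defs.idealMl hI).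
- have : l *: ((1 - P) * E) = - ((1 - P) * (y - b) * E).
    rewrite scalerAr -bE mulrBr [(1 - P) * y]mulrBl mul1r Py subrr sub0r.
    by rewrite mulNr opprK mulrA.
  move=> /(congr1 (@nrm _ _)); rewrite nrmZ nrmN => lE.
  rewrite -(ler_pM2l l0) lE (le_trans (nrmM _ _))//.
  apply: (@le_trans _ _ (nrm ((1 - P) * (y - b)))).
    by rewrite ler_piMr ?nrm_ge0// nrm_projection_le1.
  rewrite (le_trans (nrmM _ _))//.
  apply: (@le_trans _ _ (k * t)).
    by rewrite ler_pM ?nrm_ge0 ?(ltW yb)// lerDl.
  apply: (@le_trans _ _ (e * (nrm y / 2))).
    by rewrite mulrC -ler_pdivlMr// ge_min lexx orbT.
  by rewrite mulrC ler_wpM2r ?(ltW e0) ?(ltW ly).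
Qed.

(** * Boundary points of the spectrum and approximate kernels *)

(** The rightmost spectral value on a horizontal line; the supremum is attained because
    invertibility is an open condition. *)
Lemma spectrum_right_boundary (R : realType) (A : cstarAlgType R) (T : A) :
  exists2 l : R[i], spectrum T l &
    forall t : R, 0 < t -> invertible (T - (l + t%:C%C)%:A).
Proof.
have [m Tm] := spectrum_nonempty T.
pose S := [set t : R | spectrum T (m + t%:C%C)].
have S0 : S 0 by rewrite /S/= addr0.
have Sb : has_sup S.
  split; first by exists 0.
  exists (nrm T + normc m) => t /spectrum_le mt.
  apply: le_trans (lerD mt (lexx _)); apply: le_trans (ler_norm t) _.
  have := le_normcD (m + t%:C%C) (- m); rewrite normcN.
  by rewrite addrAC subrr add0r normcR.
exists (m + (sup S)%:C%C); last first.
  move=> t t0; apply: spectrumPn; rewrite -addrA -rmorphD => St.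
  have : S (sup S + t) by [].
  by move=> /(ub_le_sup Sb.2); rewrite gerDl leNgt t0.
move=> [g [Tg gT]]; have g1 : 0 < nrm g + 1 by rewrite ltr_wpDl// nrm_ge0.
have d0 : 0 < (nrm g + 1)^-1 by rewrite invr_gt0.
have [t St tS] := sup_adherent d0 Sb.
have ts : t <= sup S := ub_le_sup Sb.2 St.
apply: St; have -> : T - (m + t%:C%C)%:A =
    T - (m + (sup S)%:C%C)%:A + (sup S - t)%:C%C%:A.
  rewrite rmorphB/= -addrA; congr (_ + _); rewrite -!scaleNr -scalerDl.
  by congr (_ *: _); rewrite !opprD -addrA addKr.
apply: (invertible_perturb gT Tg); rewrite nrm_alg normcR ger0_norm ?subr_ge0//.
apply: (@le_lt_trans _ _ ((nrm g + 1) * (sup S - t))).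
  by rewrite ler_wpM2r ?subr_ge0// lerDl.
by rewrite mulrC -ltr_pdivlMr// mul1r ltrBlDr addrC -ltrBlDr.
Qed.

(** If [star S * S] were invertible, [S] would have a left inverse [c]. For an invertible [S + d]
    close to [S], [c * (S + d)] is close to [1], so [c] is invertible and [S] is its inverse. *)
Lemma not_invertible_star_mul (R : realType) (A : cstarAlgType R) (S : A) :
  ~ invertible S ->
  (forall e : R, 0 < e -> exists2 d : A, nrm d < e & invertible (S + d)) ->
  ~ invertible (star S * S).
Proof.
move=> nS approx [g [_ gS]]; apply: nS.
pose c := g * star S; have cS : c * S = 1 by rewrite -mulrA.
have k0 : 0 < (nrm c + 1)^-1 by rewrite invr_gt0 ltr_wpDl ?nrm_ge0.
have [d dk [v [Sv vS]]] := approx _ k0.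
have cSd : invertible (c * (S + d)).
  rewrite mulrDr cS -[c * d]opprK -mulrN; apply: neumann.
  rewrite (le_lt_trans (nrmM _ _))// nrmN.
  have := nrm_ge0 d; move: dk; rewrite -[_^-1]mul1r ltr_pdivlMr; last first.
    by rewrite ltr_wpDl ?nrm_ge0.
  by rewrite mulrDr mulr1 [nrm d * _]mulrC; lra.
have [b [cb bc]] : invertible c.
  rewrite -[c]mulr1 -Sv mulrA; apply: invertibleM => //.
  by exists (S + d).
have -> : S = b by rewrite -[S]mul1r -bc -mulrA cS mulr1.
by exists c.
Qed.

Lemma approximate_kernel_projection (R : realType) (A : cstarAlgType R)
    (I : set A) (S : A) (e : R) :
  real_rank_zero A -> dim_gt A 1 -> two_sided_ideal I -> essential I ->
  ~ invertible S ->
  (forall r : R, 0 < r -> exists2 d : A, nrm d < r & invertible (S + d)) ->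
  0 < e ->
  exists Q : A, [/\ I Q, self_adjoint Q /\ Q * Q = Q, Q != 0, Q != 1 &
    nrm (S * Q) <= e].
Proof.
move=> hRR hdim hI hess nS approx e0.
have e2 : 0 < e / 2 by rewrite divr_gt0.
have sSS : self_adjoint (star S * S) by rewrite /self_adjoint/= starM starK.
have [|P [sP PP P0 SSP]] := small_spectral_projection hRR sSS
  (not_invertible_star_mul nS approx) (_ : 0 < (e / 2) ^+ 2).
  by rewrite exprn_gt0.
(* The $C^*$ identity gives [nrm (S * P) ^+ 2 <= nrm (star S * S * P)], whence the squared tolerance
   above. *)
have SP : nrm (S * P) <= e / 2.
  rewrite -(@ler_pXn2r _ 2) ?nnegrE ?nrm_ge0 ?(ltW e2)// -nrm_star_mul.
  rewrite starM (sP : star P = P) -mulrA (le_trans (nrmM _ _))//.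
  rewrite mulrA (le_trans _ SSP)// ler_piMl ?nrm_ge0//.
  exact: nrm_projection_le1.
have k0 : 0 < nrm S + 1 by rewrite ltr_wpDl ?nrm_ge0.
have ek : 0 < e / 2 / (nrm S + 1) by rewrite divr_gt0.
have [E [IE sE EE E0 PE]] := essential_ideal_projection hRR hI hess PP P0 ek.
have SE : nrm (S * E) <= e.
  have -> : S * E = S * P * E + S * ((1 - P) * E).
    by rewrite mulrBl mul1r mulrBr mulrA addrC subrK.
  rewrite (le_trans (nrmD _ _))// [leRHS]splitr lerD//.
    rewrite (le_trans (nrmM _ _))// (le_trans _ SP)// ler_piMr ?nrm_ge0//.
    exact: nrm_projection_le1.
  rewrite (le_trans (nrmM _ _))//.
  apply: (@le_trans _ _ ((nrm S + 1) * (e / 2 / (nrm S + 1)))).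
    by rewrite ler_pM ?nrm_ge0// lerDl.
  by rewrite mulrC divfK// lt0r_neq0.
(* If [E = 1], then [I] is everything and [S] itself is small, so any nontrivial projection
   serves. *)
have [E1|E1] := eqVneq E 1; last by exists E.
have [F [sF FF F0 F1]] := nontrivial_projection hRR hdim.
exists F; split => //.
  by rewrite -[F]mulr1 -E1; exact: (Defs.idealMl hI).
rewrite (le_trans _ SE)// E1 mulr1 (le_trans (nrmM _ _))//.
by rewrite ler_piMr ?nrm_ge0// nrm_projection_le1.
Qed.

(** * Isolating a point of the perturbed spectrum *)

Lemma invertible_1D_idempotent (R : realType) (A : cstarAlgType R) (Q : A)
    (c : R[i]) :
  Q * Q = Q -> 1 + c != 0 -> invertible (1 + c *: Q).
Proof.
move=> QQ c1; pose e := - c / (1 + c).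
have mulE x y : y + (x + x * y) = 0 -> (1 + x *: Q) * (1 + y *: Q) = 1.
  move=> xy; rewrite mulrDl mul1r mulrDr mulr1 -scalerAl -scalerAr QQ scalerA.
  by rewrite -!addrA -!scalerDl xy scale0r addr0.
by exists (1 + e *: Q); split; apply: mulE; rewrite /e; field.
Qed.

(** The singleton [{l}] is nonempty, relatively open and closed in [S], and proper. *)
Lemma isolated_not_connected (R : realType) (S : set R[i]^o) (l m : R[i])
    (r : R) :
  0 < r -> S l -> S m -> m != l ->
  (forall z : R[i], normc (z - l) < r -> z != l -> ~ S z) -> ~ connected S.
Proof.
move=> r0 Sl Sm ml iso; move=> /(_ [set l]) H.
have : [set l] = S.
  apply: H; first by exists l.
    exists (ball (l : R[i]^o) (r%:C)%C).
      by apply: ball_open; rewrite ltcR.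
    apply/seteqP; split => [_ ->|z [Sz]] /=.
      by split => //; apply: ballxx; rewrite ltcR.
    rewrite -ball_normE/= => zl; apply: contrapT => /eqP zl'.
    apply: (iso z) => //; rewrite -ltcR; apply: le_lt_trans zl.
    by rewrite distrC normc_def; case: (z - l).
  exists [set l].
    exact/accessible_closed_set1/hausdorff_accessible/(@norm_hausdorff _ R[i]^o).
  by apply/seteqP; split => [_ ->|z []].
by move/seteqP => [_ /(_ m Sm)] /= /eqP; rewrite (negPf ml).
Qed.

Theorem theorem1p2 (R : realType) (A : cstarAlgType R)
    (hRR : real_rank_zero A) (hdim : dim_gt A 1)
    (I : set A) (hI : two_sided_ideal I) (hess : essential I)
    (T : A) (eps : R) (heps : 0 < eps) :
  exists X : A,
    [/\ I X, `|X| < (eps%:C)%C & ~ connected (spectrum (T + X))].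
Proof.
have [l0 Tl0 right] := spectrum_right_boundary T.
pose S := T - l0%:A; pose d := eps / 2; have d0 : 0 < d by rewrite divr_gt0.
pose dC : R[i] := d%:C%C; have dC0 : dC != 0.
  by rewrite /dC fmorph_eq0 lt0r_neq0.
pose l1 := l0 + dC.
have [g [l1g gl1]] : invertible (T - l1%:A) by exact: right.
pose k := nrm g + 1; have k0 : 0 < k by rewrite ltr_wpDl ?nrm_ge0.
(* The bound [d / 2] keeps [nrm X <= r + d < eps] and [l0] outside the ball of radius [r] about
   [l1]; the other keeps [T1 - z] invertible in that ball, where it differs from [T - l1] by at most
   [2 * r]. *)
pose r := Num.min (d / 2) (4 * k)^-1.
have r0 : 0 < r by rewrite lt_min divr_gt0//= invr_gt0 mulr_gt0.
have [|Q [IQ [sQ QQ] Q0 Q1 SQ]] :=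
  approximate_kernel_projection hRR hdim hI hess (Tl0 : ~ invertible S) _ r0.
  move=> e e0; exists (- (e / 2)%:C%C%:A).
    by rewrite nrmN nrm_alg normcR gtr0_norm ?divr_gt0//; lra.
  by rewrite /S -addrA -opprD -scalerDl; apply: right; rewrite divr_gt0.
pose T1 := T - S * Q.
have T1Q : T1 * Q = l0 *: Q.
  by rewrite mulrBl -mulrA QQ /S -mulrBl opprB addrC subrK mulr_algl.
have T1inv z : normc (z - l1) < r -> invertible (T1 - z%:A).
  move=> zr; pose D := - (S * Q) - (z - l1)%:A.
  have -> : T1 - z%:A = (T - l1%:A) + D.
    by rewrite /D scalerBl opprB [- (S * Q) + _]addrC !addrA subrK addrAC.
  apply: (invertible_perturb gl1 l1g).
  have Dr : nrm D <= 2 * r.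
    rewrite (le_trans (nrmD _ _))// !nrmN nrm_alg mulr_natl mulr2n lerD//.
    exact: ltW.
  have rk : r <= (4 * k)^-1 by rewrite ge_min lexx orbT.
  have kk : (4 * k)^-1 * k = 4^-1.
    by rewrite invfM -mulrA mulVf ?mulr1// lt0r_neq0.
  have := nrm_ge0 g; have := nrm_ge0 D.
  have : r * k <= 4^-1 by rewrite -kk ler_wpM2r ?(ltW k0).
  have : nrm g * nrm D <= k * (2 * r) by rewrite ler_pM ?nrm_ge0// lerDl.
  by lra.
pose X := - (S * Q) + dC *: Q.
have TX : T + X = T1 + dC *: Q by rewrite /X addrA.
have TXQ : (T + X) * Q = l1 *: Q.
  by rewrite TX mulrDl T1Q -scalerAl QQ -scalerDl.
exists X; split.
- rewrite /X addrC -mulr_algl; apply: (Defs.idealB hI);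
    exact: (Defs.idealMl hI).
- rewrite nrmE ltcR (le_lt_trans (nrmD _ _))// nrmN nrmZ normcR gtr0_norm//.
  have : d * nrm Q <= d by rewrite ler_piMr ?(ltW d0)// nrm_projection_le1.
  have : r <= d / 2 by rewrite ge_min lexx.
  by move: SQ d0; rewrite /d; lra.
have l1X : spectrum (T + X) l1.
  move=> [w [_ wl]]; move/eqP: Q0; apply.
  by rewrite -[Q]mul1r -wl -mulrA mulrBl TXQ mulr_algl subrr mulr0.
(* Undoing the shift by [dC] on [Q] leaves [T1 - l1], which is invertible; this supplies a second
   spectral value [m + l1]. *)
have [|||m m0 Xm] := @corner_spectrum _ _ (T + X - l1%:A) Q (- dC) _ QQ Q1.
- by rewrite oppr_eq0.
- by rewrite mulrBl TXQ mulr_algl subrr.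
- rewrite TX scaleNr addrAC addrK; apply: T1inv.
  by rewrite subrr normc0.
apply: (@isolated_not_connected _ _ l1 (m + l1) r) => //.
- move: Xm; rewrite /spectrum/= [m + l1]addrC.
  by rewrite (scalerDl 1 l1) opprD (addrA (T + X)).
- by apply: contra_neq m0 => ml; apply: (addIr l1); rewrite ml add0r.
move=> z zr zl1; apply.
have zl0 : l0 - z != 0.
  apply/eqP => /subr0_eq zl0; move: zr.
  rewrite -zl0 /l1 opprD addrA subrr sub0r normcN normcR gtr0_norm//.
  by rewrite lt_min ltNge ler_pdivrMr// ler_peMr ?(ltW d0)// ler1n.
(* Here [(T1 - z) Q = (l0 - z) Q]; the second factor is invertible because [l0 - z + dC = l1 - z] is
   nonzero. *)
have -> : T + X - z%:A = (T1 - z%:A) * (1 + (dC / (l0 - z)) *: Q).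
  rewrite mulrDr mulr1 -scalerAr mulrBl T1Q mulr_algl -scalerBl scalerA.
  by rewrite divfK// TX addrAC.
apply: invertibleM; first exact: T1inv.
apply: invertible_1D_idempotent => //.
rewrite -{1}(divff zl0) -mulrDl mulf_eq0 invr_eq0 (negPf zl0) orbF.
by rewrite addrAC -/l1 subr_eq0 eq_sym.
Qed.
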